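(* Let $\mathbf b=b_0b_1b_2\cdots$ be any infinite sequence over $\{1,-1\}$ and let $\mathbf f=f_1f_2f_3\cdots$ be the paper-folding word defined by $\mathbf b$. Then for every positive integer $m$ the word $\mathbf f$ contains an abelian $m$-power.
   Context: The paper-folding word $\mathbf f=f_1f_2f_3\cdots$ over $\{1,-1\}$ defined by a sequence of instructions $\mathbf b=b_0b_1b_2\cdots\in\{1,-1\}^{\mathbb N}$ is given by $f_i=(-1)^j b_k$, where $i=2^k(2j+1)$ with $k,j\ge 0$. A word $w$ is an abelian $m$-power if $w=w_1w_2\cdots w_m$ where for all $i,j\in\{1,\dots,m\}$ the word $w_j$ is obtained from $w_i$ by a permutation of its letters (i.e. $|w_i|_a=|w_j|_a$ for each letter $a$, where $|u|_a$ is the number of occurrences of $a$ in $u$). The word $\mathbf f$ contains an abelian $m$-power if some nonempty factor $f_if_{i+1}\cdots f_j$ with $0<i\le j$ is an abelian $m$-power. *)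

(* Defs.v *)
From mathcomp Require Import all_boot all_order all_algebra.
Set Implicit Arguments. Unset Strict Implicit. Unset Printing Implicit Defensive.
Import GRing.Theory Num.Theory.
Local Open Scope ring_scope.

(* A sequence of instructions b = b_0 b_1 ... over {1,-1}, as an int-valued
   sequence (the hypothesis that values lie in {1,-1} is in the theorem). *)

(* Paper-folding word: for i = 2^k (2j+1), f_i = (-1)^j b_k.
   k = logn 2 i (2-adic valuation), 2j+1 = i %/ 2^k, j = (i %/ 2^k)./2.
   f 0 is irrelevant (only indices i >= 1 are used). *)
Definition paperfold (b : nat -> int) (i : nat) : int :=
  let k := logn 2 i in
  let j := ((i %/ 2 ^ k)%N)./2 in
  (-1) ^+ j * b k.

Definition factor (f : nat -> int) (i j : nat) : seq int :=
  [seq f n | n <- iota i (j.+1 - i)].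

Definition abelian_power {T : eqType} (m : nat) (w : seq T) : Prop :=
  exists ws : seq (seq T),
    [/\ size ws = m, flatten ws = w &
        forall u v, u \in ws -> v \in ws -> perm_eq u v].

Definition contains_abelian_power (f : nat -> int) (m : nat) : Prop :=
  exists i j : nat, [/\ (0 < i)%N, (i <= j)%N & abelian_power m (factor f i j)].

(* Main.v *)
Require Import Defs.
From Stdlib Require Import Classical.
From mathcomp Require Import all_boot all_order all_algebra.
From mathcomp Require Import zify ring.
Import GRing.Theory.
Local Open Scope ring_scope.

(** Let [psum b n] be the sum of the first [n] letters.  An abelian [m]-power is
    an arithmetic progression of [m + 1] indices along which [psum b] is affine.
    The partial sums are additive over separated binary blocks:
    [psum b (2^a * 2y + x) = psum b x + psum (b shifted by a) (2y)] if [x < 2^a].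
    Some instruction pattern [u] of any prescribed length occurs infinitely often
    in [b]; placing [2i], for [i < N = 2^K], at pairwise separated occurrences of
    [u] gives a start [n0], and placing a [2] at each of them a step [d], with
    [psum b (n0 + j d) = \sum_(i < N) psum u (2(i + j))].  The increment of the
    right-hand side in [j] is [psum u (2N + 2j) - psum u (2j)], which by additivity
    does not depend on [j] as long as [2j < N]. *)

Definition shift (s : nat) (b : nat -> int) (k : nat) : int := b (s + k)%N.

Definition psum (b : nat -> int) (n : nat) : int :=
  \sum_(0 <= i < n) paperfold b i.+1.

Lemma psum0 b : psum b 0 = 0.
Proof. by rewrite /psum big_geq. Qed.

Lemma psumS b n : psum b n.+1 = psum b n + paperfold b n.+1.
Proof. by rewrite /psum big_nat_recr. Qed.

Lemma paperfold_odd b j : paperfold b j.*2.+1 = (-1) ^+ j * b 0%N.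
Proof.
have lg0 : logn 2 j.*2.+1 = 0%N by rewrite lognE dvdn2 /= odd_double.
by rewrite /paperfold lg0 expn0 divn1 /= uphalf_double.
Qed.

Lemma paperfold_even b i : (0 < i)%N ->
  paperfold b i.*2 = paperfold (shift 1 b) i.
Proof.
move=> i_gt0; rewrite /paperfold -mul2n lognM // logn_prime //= /shift.
by rewrite expnS divnMl.
Qed.

(* Unfolded completely, this says that [psum b n] sums the instructions [b k] at
   the positions where the bits [k] and [k + 1] of [n] differ. *)
Lemma psum_half b n :
  psum b n = psum (shift 1 b) n./2 + b 0%N *+ (odd n (+) odd n./2).
Proof.
(* Among the first [2h] letters the even positions spell the word of [shift 1 b], and the odd ones
   alternate [b 0], [- b 0], cancelling in pairs. *)
have even_half h : psum b h.*2 = psum (shift 1 b) h + b 0%N *+ odd h.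
  elim: h => [|h IHh]; first by rewrite !psum0 addr0.
  rewrite doubleS !psumS IHh paperfold_odd -doubleS paperfold_even //.
  rewrite -signr_odd oddS; case: (odd h) => /=;
    by rewrite ?expr0 ?expr1 ?mulr0n ?mulr1n; ring.
rewrite -{1 3}(odd_double_half n) oddD odd_double addbF oddb.
case: (odd n); last by rewrite add0n even_half.
rewrite add1n psumS even_half paperfold_odd -signr_odd.
by case: (odd n./2) => /=; rewrite ?expr0 ?expr1 ?mulr0n ?mulr1n; ring.
Qed.

(** Bit [a] of the index is zero, as it is in [x], so the bit changes below it are those of [x] and
    the others are those of [y.*2]. This is why the upper part is doubled. *)
Lemma psum_blocks b a x y : (x < 2 ^ a)%N ->
  psum b (2 ^ a * y.*2 + x)%N = psum b x + psum (shift a b) y.*2.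
Proof.
elim: a b x => [|a IHa] b x.
  by rewrite expn0 ltnS leqn0 => /eqP->; rewrite mul1n addn0 psum0 add0r.
rewrite expnS => x_lt.
have half_n : (2 * 2 ^ a * y.*2 + x)./2 = (2 ^ a * y.*2 + x./2)%N.
  by rewrite -mulnA mul2n halfD odd_double doubleK.
have odd_n : odd (2 * 2 ^ a * y.*2 + x) = odd x.
  by rewrite oddD !oddM.
have odd_half : odd (2 ^ a * y.*2 + x./2) = odd x./2.
  by rewrite oddD oddM odd_double andbF.
rewrite psum_half half_n odd_n odd_half IHa; last by lia.
by rewrite [psum b x]psum_half addrAC; congr (_ + _ + _).
Qed.

Lemma eq_psum b u L n : (n < 2 ^ L)%N ->
  (forall k, (k < L)%N -> b k = u k) -> psum b n = psum u n.
Proof.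
elim: L b u n => [|L IHL] b u n.
  by rewrite expn0 ltnS leqn0 => /eqP-> _; rewrite !psum0.
rewrite expnS => n_lt eq_bu.
rewrite !(psum_half _ n) eq_bu //; congr (_ + _).
by apply: IHL => [|k k_lt]; [lia | rewrite /shift eq_bu // add1n].
Qed.

(** Induction on [L]: either [u] followed by [1] recurs forever, or from some [M0] on every
    occurrence of [u] is followed by [-1]. *)
Lemma recurrent_pattern (b : nat -> int) :
  (forall k, b k = 1 \/ b k = -1) ->
  forall L, exists u : nat -> int, forall M, exists2 s, (M <= s)%N &
    forall k, (k < L)%N -> shift s b k = u k.
Proof.
move=> hb; elim=> [|L [u Hu]]; first by exists b => M; exists M.
pose ext c k : int := if k == L then c else u k.
have [[M0 no1]|all1] := classic (exists M0, forall s, (M0 <= s)%N ->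
    (forall k, (k < L)%N -> shift s b k = u k) -> b (s + L)%N <> 1).
- exists (ext (-1)) => M; have [s s_ge Hs] := Hu (maxn M M0).
  exists s => [|k]; first by lia.
  rewrite ltnS leq_eqVlt /ext; case: eqP => [-> _ | _ /= k_lt]; last exact: Hs.
  by have := no1 s _ Hs; case: (hb (s + L)%N) => // -> []; lia.
- exists (ext 1) => M; apply: NNPP => noM; case: all1; exists M => s s_ge Hs b1.
  case: noM; exists s => // k.
  by rewrite ltnS leq_eqVlt /ext; case: eqP => [-> _ | _ /= k_lt]; [|exact: Hs].
Qed.

(** The bound on [N + m] keeps every [2(p + j)] inside one copy of [u]; [p <= d] later yields a
    positive step. *)
Lemma stack_blocks b u L m N :
  (forall M, exists2 s, (M <= s)%N & forall k, (k < L)%N -> shift s b k = u k) ->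
  ((N + m).*2 < 2 ^ L)%N ->
  forall p, (p <= N)%N -> exists n0 d, (p <= d)%N /\
    forall j, (j <= m)%N ->
      psum b (n0 + j * d)%N = \sum_(0 <= i < p) psum u (i + j).*2.
Proof.
move=> rec_u N_lt; elim=> [|p IHp] p_le.
  by exists 0%N, 0%N; split=> // j _; rewrite muln0 psum0 big_geq.
have [n0 [d [d_ge Hd]]] := IHp (ltnW p_le).
have [s s_ge Hs] := rec_u (n0 + m * d)%N.
exists (n0 + 2 ^ s * p.*2)%N, (d + 2 ^ s * 2)%N; split=> [|j j_le].
  by have := expn_gt0 2 s; lia.
have -> : (n0 + 2 ^ s * p.*2 + j * (d + 2 ^ s * 2)
    = 2 ^ s * (p + j).*2 + (n0 + j * d))%N by rewrite -!mul2n; ring.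
(* Separation: [n0 + j d <= n0 + m d <= s < 2 ^ s]. *)
rewrite psum_blocks; last first.
  apply: leq_trans (ltn_expl s (isT : 1 < 2)%N); rewrite ltnS.
  by apply: leq_trans s_ge; rewrite leq_add2l leq_mul2r j_le orbT.
rewrite Hd // big_nat_recr //=; congr (_ + _).
by apply: eq_psum Hs; lia.
Qed.

Lemma sum_psum_affine u K m j : (m.*2 < 2 ^ K)%N -> (j < m)%N ->
  \sum_(0 <= i < 2 ^ K) psum u (i + j.+1).*2
    = \sum_(0 <= i < 2 ^ K) psum u (i + j).*2 + psum (shift K u) 2.
Proof.
move=> m_lt j_lt; pose F i := psum u (i + j).*2.
rewrite (eq_bigr (fun i => F i.+1)) => [|i _]; last by rewrite /F addnS.
have telesc : F 0%N + \sum_(0 <= i < 2 ^ K) F i.+1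
    = \sum_(0 <= i < 2 ^ K) F i + F (2 ^ K)%N.
  by rewrite -big_nat_recl // -big_nat_recr.
have FN : F (2 ^ K)%N = F 0%N + psum (shift K u) 2.
  rewrite /F doubleD add0n -[(2 ^ K).*2]muln2.
  by rewrite (psum_blocks u K _ 1) //; lia.
by apply: (addrI (F 0%N)); rewrite telesc FN addrCA.
Qed.

Lemma psum_affine b : (forall k, b k = 1 \/ b k = -1) ->
  forall m, exists n0 d c, (0 < d)%N /\
    forall j, (j < m)%N ->
      psum b (n0 + j.+1 * d)%N = psum b (n0 + j * d)%N + c.
Proof.
(* Since [n < 2 ^ n], these choices give [2m < 2 ^ K] and [2(2 ^ K + m) < 2 ^ L]. *)
move=> hb m; pose K := m.*2; pose L := (2 ^ K + m).*2.
have [u Hu] := recurrent_pattern b hb L.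
have [||n0 [d [d_ge Hd]]] := stack_blocks b u L m (2 ^ K) Hu _ (2 ^ K) => //.
  exact: ltn_expl.
exists n0, d, (psum (shift K u) 2); split=> [|j j_lt].
  by apply: leq_trans d_ge; rewrite expn_gt0.
by rewrite !Hd ?(ltnW j_lt) // (sum_psum_affine u K m) // ltn_expl.
Qed.

Lemma paperfold_pm1 b i : (forall k, b k = 1 \/ b k = -1) ->
  paperfold b i \in [:: 1; -1].
Proof.
move=> hb; rewrite /paperfold -signr_odd !inE.
by case: (hb (logn 2 i)) => ->; case: odd.
Qed.

(** Length and sum are the sum and the difference of the numbers of [1] and [-1], hence determine
    both. *)
Lemma perm_eq_pm1 (u v : seq int) :
  all [in [:: 1; -1]] u -> all [in [:: 1; -1]] v ->
  size u = size v -> \sum_(x <- u) x = \sum_(x <- v) x -> perm_eq u v.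
Proof.
have counts (w : seq int) : all [in [:: 1; -1]] w ->
    [/\ size w = (count_mem 1%R w + count_mem (-1)%R w)%N,
        \sum_(x <- w) x = (count_mem 1 w)%:Z - (count_mem (-1) w)%:Z &
        forall a : pred int,
          count a w = (a 1%R * count_mem 1%R w + a (-1)%R * count_mem (-1)%R w)%N].
  elim: w => [|x w IHw] /=.
    by split=> [||a]; rewrite ?big_nil ?subrr ?muln0.
  case/andP; rewrite !inE => x_pm1 /IHw[szw sumw cntw].
  rewrite big_cons szw sumw; move: (count_mem 1 w) (count_mem (-1) w) cntw.
  move=> c1 cN1 cntw {szw sumw}.
  case/orP: x_pm1 => /eqP->; split=> [||a];
    rewrite ?cntw ?eqxx ?add1n ?add0n ?addnS //=.
  - by rewrite intS addrA.
  - by rewrite mulnS addnA.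
  - by rewrite (intS cN1) opprD addrCA.
  - by rewrite mulnS addnCA.
move=> /counts[szu sumu cntu] /counts[szv sumv cntv] eq_sz eq_sum.
have [eq1 eqN1] : count_mem 1 u = count_mem 1 v
    /\ count_mem (-1) u = count_mem (-1) v by lia.
by apply/permP => a; rewrite cntu cntv eq1 eqN1.
Qed.

Lemma flatten_iota n d m :
  flatten [seq iota (n + q * d) d | q <- iota 0 m] = iota n (m * d).
Proof.
elim: m => [|m IHm]; first by rewrite mul0n.
by rewrite -[in LHS]addn1 iotaD map_cat flatten_cat IHm /= cats0 -iotaD mulSnr.
Qed.

Lemma sum_paperfold_iota b n d :
  \sum_(x <- [seq paperfold b i | i <- iota n.+1 d]) x = psum b (n + d)%N - psum b n.
Proof.
rewrite big_map; elim: d => [|d IHd]; first by rewrite big_nil addn0 subrr.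
by rewrite -[in LHS](addn1 d) iotaD big_cat IHd /= big_seq1 addnS psumS addSn addrAC.
Qed.

Theorem theorem5p4 (b : nat -> int)
  (hb : forall k : nat, b k = 1 \/ b k = -1) (m : nat) (hm : (0 < m)%N) :
  contains_abelian_power (paperfold b) m.
Proof.
have [n [d [c [d_gt0 Hc]]]] := psum_affine b hb m.
have md_gt0 : (0 < m * d)%N by rewrite muln_gt0 hm.
(* [psum b n] ends with letter [n], so the blocks start at [n + 1]; each has length [d] and sum
   [c]. *)
exists n.+1, (n + m * d)%N; split=> //; first by lia.
exists [seq [seq paperfold b i | i <- iota (n.+1 + q * d) d] | q <- iota 0 m].
split; first by rewrite size_map size_iota.
  rewrite (map_comp (map (paperfold b)) (fun q => iota (n.+1 + q * d) d)).
  by rewrite -map_flatten flatten_iota /factor subSS addKn.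
move=> _ _ /mapP[q q_in ->] /mapP[r r_in ->]; apply: perm_eq_pm1.
- by apply/allP => _ /mapP[i _ ->]; apply: paperfold_pm1.
- by apply/allP => _ /mapP[i _ ->]; apply: paperfold_pm1.
- by rewrite !size_map !size_iota.
have block_sum p : p \in iota 0 m ->
    \sum_(x <- [seq paperfold b i | i <- iota (n.+1 + p * d) d]) x = c.
  rewrite mem_iota add0n => /andP[_ p_lt].
  by rewrite addSn sum_paperfold_iota -addnA -mulSnr Hc // addrC addKr.
by rewrite !block_sum.
Qed.
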